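(* Let $X$ be a regular diffusion on an interval $I\subset\mathbb{R}$ with speed measure $m^X$, let $a,b\in I$ with $a<b$, and let $x\in(a,b)$. Let $\mathcal{T}_{(a,b)}:=\inf\{t>0: X_t\notin(a,b)\}$ and let $\widehat q_t(\cdot,\cdot)$ be the transition density with respect to $m^X$ of $X$ killed at $\mathcal{T}_{(a,b)}$. If $\mathbb{P}^X_x(\mathcal{T}_{(a,b)}<\infty)=1$ (i.e. $X$ does not die inside $(a,b)$), then $$\mathbb{E}^X_x[\mathcal{T}_{(a,b)}]=\int_0^\infty dt\int_a^b m^X(dz)\,\widehat q_t(x,z).$$
   Context: $X=(X_t)_{t\ge0}$ is a regular diffusion on $I$ in the sense of Itô and McKean, realized as the coordinate process on $C[0,\infty)$; $\mathbb{P}^X_x$ is its law started from $x\in I$ and $\mathbb{E}^X_x$ the corresponding expectation. There is a speed measure $m^X$ such that $\mathbb{P}^X_x(X_t\in dy)=q_t(x,y)\,m^X(dy)$ with $(t,x,y)\mapsto q_t(x,y)$ continuous and strictly positive for $t>0$, $x,y\in I$. The infimum of the empty set is $\infty$. The process $\widehat X$ is $X$ killed at $\mathcal{T}_{(a,b)}$; it is a regular diffusion on $(a,b)$ with the same speed measure $m^X$, and it has a continuous strictly positive transition density $\widehat q_t(x,y)$ with respect to $m^X$, characterized for $x,y\in(a,b)$ by $\widehat q_t(x,y)\,m^X(dy)=\mathbb{P}^X_x(X_t\in dy,\ \mathcal{T}_{(a,b)}>t)$. *)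

(* Defs.v *)
From HB Require Import structures.
From mathcomp Require Import all_boot all_order all_algebra.
From mathcomp Require Import all_classical all_reals all_analysis.
From mathcomp Require Import measurable_realfun.
Import Order.TTheory GRing.Theory Num.Theory.
Import numFieldNormedType.Exports.

Set Implicit Arguments.
Unset Strict Implicit.
Unset Printing Implicit Defensive.

Local Open Scope classical_set_scope.
Local Open Scope ring_scope.

Section PathSpace.
Context (R : realType) (I : set R).

(* [None] is the cemetery: a path has a lifetime zeta in [0, +oo] and is dead
   from zeta on.  [coord_cont] says both that the set of alive times is
   relatively open in [0, +oo[, hence equal to [0, zeta[, and that the path is
   continuous on it.  The paths with zeta = +oo are exactly the elements of
   C([0, +oo[, I). *)
Record path := Path {
  coord : {nonneg R} -> option R ;
  coord_state : forall t y, coord t = Some y -> I y ;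
  coord_dead : forall s t : {nonneg R}, s%:num <= t%:num ->
    coord s = None -> coord t = None ;
  coord_cont : forall t y, coord t = Some y ->
    forall e : R, 0 < e -> exists2 d : R, 0 < d &
      forall s : {nonneg R}, `|s%:num - t%:num| < d ->
        exists2 z, coord s = Some z & `|z - y| < e }.

Definition dead_path : path.
Proof. by exists (fun=> None). Defined.

Definition shift (r : {nonneg R}) (w : path) : path.
Proof.
exists (fun t => coord w (r%:num + t%:num)%:nng).
- by move=> t y; exact: coord_state.
- by move=> s t st; apply: coord_dead; rewrite /= lerD2l.
- move=> t y wt e e0; have [d d0 wd] := coord_cont wt e0.
  exists d => // s st; apply: wd => /=.
  by rewrite opprD addrACA subrr add0r.
Defined.

HB.instance Definition _ := gen_eqMixin path.
HB.instance Definition _ := gen_choiceMixin path.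
HB.instance Definition _ := isPointed.Build path dead_path.

Definition cylinders (D : set {nonneg R}) : set (set path) :=
  [set C | exists t (A : set R), [/\ D t, measurable A &
     C = [set w | exists2 y, coord w t = Some y & A y]]].

Definition path_space := g_sigma_algebraType (cylinders setT).

(* F_t = sigma(X_s, s <= t) *)
Definition natural_filtration (t : R) : set (set path) :=
  <<s cylinders [set s | s%:num <= t] >>.

(* A random time takes values in [0, +oo], with [None] standing for +oo. *)
Definition before (tau : path -> option {nonneg R}) (t : R) : set path :=
  [set w | exists2 s, tau w = Some s & s%:num < t].

Definition optional_time (tau : path -> option {nonneg R}) :=
  forall t : R, 0 < t -> natural_filtration t (before tau t).

(* the sigma-algebra F_(tau+) *)
Definition optional_past (tau : path -> option {nonneg R}) : set (set path) :=
  [set A | measurable (A : set path_space) /\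
    forall t : R, 0 < t -> natural_filtration t (A `&` before tau t)].

(* X_tau, which is [None] if tau = +oo or if the path is dead at time tau *)
Definition coord_at (tau : path -> option {nonneg R}) (w : path) : option R :=
  obind (coord w) (tau w).

(* the event {tau < zeta, theta_tau \in B} *)
Definition alive_shift_in (tau : path -> option {nonneg R}) (B : set path) :
    set path :=
  [set w | exists r, [/\ tau w = Some r, coord w r <> None & B (shift r w)]].

Definition strong_markov (P : R -> probability path_space R) :=
  forall (x : R) (tau : path -> option {nonneg R}) (A B : set path_space),
    I x -> optional_time tau -> optional_past tau A -> measurable B ->
    (P x (A `&` alive_shift_in tau B) =
     \int[P x]_(w in A) (if coord_at tau w is Some y then P y B else 0))%E.

(* Only the laws P x with x in I are meaningful.  The Markov times are those of
   the right-continuous filtration, and regularity is required between interior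
   points, so that I may contain an entrance boundary point. *)
Record regular_diffusion (P : R -> probability path_space R) : Prop := {
  diffusion_interval : is_interval I ;
  diffusion_measurable : forall B : set path_space, measurable B ->
    measurable_fun I (fun x => P x B) ;
  diffusion_start : forall x, I x ->
    P x [set w | coord w 0%:nng = Some x] = 1%E ;
  diffusion_strong_markov : strong_markov P ;
  diffusion_regular : forall x y, I° x -> I° y ->
    (0 < P x [set w | exists t, coord w t = Some y])%E }.

(* inf {t > 0 | X_t \notin (a, b)}, where X_t ranges over the actual positions
   of the path: dying is not an exit, and a path which dies inside (a, b) before
   leaving it has an infinite exit time. *)
Definition exit_time (a b : R) (w : path) : \bar R :=
  ereal_inf [set t%:num%:E | t in [set t : {nonneg R} |
    0 < t%:num /\ exists2 y, coord w t = Some y & y \notin `]a, b[ ]].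

Definition killed (T : path -> \bar R) (t : {nonneg R}) (w : path) : option R :=
  if (t%:num%:E < T w)%E then coord w t else None.

(* [Y] is a process with values in J and the cemetery; q is its continuous and
   strictly positive transition density with respect to m: for t > 0 and x in J,
   P_x (Y_t \in dy) = q_t(x, y) m(dy) on J.  With [Y := killed T] the left-hand
   side is P_x (X_t \in dy, T > t). *)
Record transition_density (J : set R) (Y : {nonneg R} -> path -> option R)
    (P : R -> probability path_space R) (m : {measure set R -> \bar R})
    (q : R -> R -> R -> R) : Prop := {
  density_pos : forall t x y, 0 < t -> J x -> J y -> 0 < q t x y ;
  density_continuous :
    {within [set p : R * R * R | [/\ 0 < p.1.1, J p.1.2 & J p.2]],
      continuous (fun p => q p.1.1 p.1.2 p.2)} ;
  density_law : forall (t : {nonneg R}) (x : R) (A : set R),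
    0 < t%:num -> J x -> measurable A -> A `<=` J ->
    (P x [set w | exists2 y, Y t w = Some y & A y] =
     \int[m]_(y in A) (q t%:num x y)%:E)%E }.

(* The reference measure of the diffusion, normalised, as is usual, by the
   symmetry of its density; this determines it up to a positive constant. *)
Definition speed_measure (P : R -> probability path_space R)
    (m : {measure set R -> \bar R}) : Prop :=
  (forall c d : R, I° c -> I° d -> c < d -> (0 < m `[c, d]%classic < +oo)%E) /\
  exists q, transition_density I (fun t w => coord w t) P m q /\
    forall t x y, 0 < t -> I x -> I y -> q t x y = q t y x.

End PathSpace.

(* Main.v *)
From HB Require Import structures.
Require Import Defs.
From mathcomp Require Import all_boot all_order all_algebra.
From mathcomp Require Import all_classical all_reals all_analysis.
From mathcomp Require Import measurable_realfun lra.
Import Order.TTheory GRing.Theory Num.Theory.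
Import numFieldNormedType.Exports.
Import Defs.

(** Write T for the exit time.  For a nonnegative random variable that is almost
    surely finite, the expectation is the integral over t > 0 of the survival
    probability P_x(T > t) ([ge0_integral_survival]).  By the defining property
    of the density, the integral of qhat_t(x, z) m(dz) over (a, b) is
    P_x(X_t \in (a, b), T > t), so it suffices that the two probabilities agree
    for each t > 0.  They agree because, on the almost sure event T < oo, a path
    with T > t is still alive at time t (it has a position at some later exit
    time) and lies in (a, b) at time t, since otherwise t itself would be an
    exit time ([alive_inside_before_exit]).  On T = oo the two events may differ,
    as a path can die inside (a, b): this is where the hypothesis P_x(T < oo) = 1
    enters.

    The remaining work is the measurability of T for the sigma-algebra generated
    by the coordinates.  The event T < t asks for an exit at one of uncountably
    many times.  As the set of alive times is open, such an exit happens inside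
    some interval [u, v] with rational ends, v < t, and the path alive at v
    ([exit_time_lt]).  On such a compact interval the path is continuous, so
    reaching the closed complement of (a, b) means coming arbitrarily close to it
    at rational times ([exit_within_ratP]), a countable condition. *)

(** * Measurability of the exit time *)

Local Open Scope classical_set_scope.
Local Open Scope ring_scope.

Section ExitTime.
Context (R : realType) (I : set R).
Implicit Types (w : path I) (a b y z : R).

Definition position_in (t : {nonneg R}) (A : set R) : set (path I) :=
  [set w | exists2 y, coord w t = Some y & A y].

Lemma measurable_position_in (t : {nonneg R}) (A : set R) : measurable A ->
  measurable (position_in t A : set (path_space I)).
Proof. by move=> mA; apply: sub_sigma_algebra; exists t, A; split. Qed.

(** Total on the reals, so that a path can be handled as a function on the real
    line; only its values at nonnegative arguments matter. *)
Definition time_of (s : R) : {nonneg R} := `|s|%:nng.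

Lemma time_ofE (s : R) : 0 <= s -> (time_of s)%:num = s.
Proof. exact: ger0_norm. Qed.

(** For y inside (a, b), the distance to the complement.  Turning membership into
    the sign of a Lipschitz function makes the extreme value theorem available. *)
Definition depth a b y : R := Num.min (y - a) (b - y).

Lemma depth_gt0 a b y : (0 < depth a b y) = (y \in `]a, b[).
Proof. by rewrite lt_min !subr_gt0 in_itv. Qed.

Lemma depth_lipschitz a b y z : `|depth a b y - depth a b z| <= `|y - z|.
Proof.
rewrite /depth; case: (leP (y - a)); case: (leP (z - a)) => h1 h2;
rewrite ler_norml; apply/andP; have := ler_norm (y - z);
by have := ler_norm (z - y); rewrite distrC; split; lra.
Qed.

Lemma measurable_depth a b : measurable_fun setT (depth a b).
Proof.
apply: measurable_minr; first exact: measurable_funB.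
exact: measurable_funB.
Qed.

(** The value 0 at dead times is arbitrary: only alive times are considered. *)
Definition path_depth a b w (s : R) : R :=
  if coord w (time_of s) is Some y then depth a b y else 0.

Lemma path_depth_continuous a b w (s : R) :
  coord w (time_of s) <> None -> {for s, continuous (path_depth a b w)}.
Proof.
case ws: (coord w _) => [y|//] _.
apply/cvgrPdist_lt => e e0 /=.
have [d d0 wd] := coord_cont ws e0.
apply/nbhs_ballP; exists d => //= t st.
have [|z wt zy] := wd (time_of t).
  by rewrite /= (le_lt_trans (ler_dist_dist _ _))// distrC.
rewrite /path_depth ws wt distrC.
exact: le_lt_trans (depth_lipschitz _ _ _ _) zy.
Qed.

Lemma coord_alive_le w (s t : {nonneg R}) :
  s%:num <= t%:num -> coord w t <> None -> coord w s <> None.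
Proof. by move=> st wt ws; apply: wt; exact: coord_dead ws. Qed.

(** The path is alive, hence continuous, on the whole of [u, v].  If rational
    times bring the depth below every 1/(n+1), the minimum of the depth over the
    compact interval is nonpositive; the converse is density of the rationals.
    The strict inequality u < v provides rational times on at least one side of
    an exit at an end of the interval. *)
Lemma exit_within_ratP a b w (u v : R) : 0 <= u -> u < v ->
  coord w (time_of v) <> None ->
  (exists2 s, s \in `[u, v] & path_depth a b w s <= 0) <->
  (forall n, exists2 q : rat, ratr q \in `[u, v] &
     path_depth a b w (ratr q) < n.+1%:R^-1).
Proof.
move=> u0 uv wv.
have cw s : s \in `[u, v] -> {for s, continuous (path_depth a b w)}.
  rewrite in_itv/= => /andP[us sv]; apply: path_depth_continuous.
  by apply: coord_alive_le wv; rewrite !time_ofE//; lra.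
split=> [[s suv ws] n|near0].
  have n0 : 0 < n.+1%:R^-1 :> R by rewrite invr_gt0.
  have /cvgrPdist_lt/(_ _ n0)/nbhs_ballP[d /= d0 wd] := cw _ suv.
  (* The window around s is cut down to ]u, v[, still nonempty as u < v. *)
  have [q] : exists q : rat,
      ratr q \in `](Num.max u (s - d)), (Num.min v (s + d))[.
    apply: rat_in_itvoo; move: suv.
    rewrite in_itv/= => /andP[us sv]; rewrite gt_max !lt_min.
    by apply/andP; split; apply/andP; split; lra.
  rewrite in_itv/= gt_max lt_min => /andP[/andP[uq sq] /andP[qv qs]].
  exists q; first by rewrite in_itv/=; apply/andP; split; lra.
  have /wd : ball s d (ratr q).
    by rewrite -ball_normE/= ltr_norml; apply/andP; split; lra.
  by rewrite /= ltr_norml => /andP[+ _]; move: ws; set e := _^-1; lra.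
have [|c cuv cmin] := @EVT_min R (path_depth a b w) u v (ltW uv).
  by apply: continuous_in_subspaceT => s; rewrite inE; exact: cw.
exists c => //; rewrite leNgt; apply/negP => c0.
have [n] := ltr_add_invr c0; rewrite add0r => nc.
have [q quv qn] := near0 n.
by have := lt_trans (lt_le_trans nc (cmin _ quv)) qn; rewrite ltxx.
Qed.

(** Life at time v is required so that the whole of [u, v] lies in the lifetime
    of the path. *)
Definition exits_within a b (u v : R) : set (path I) :=
  [set w | coord w (time_of v) <> None /\
    exists2 s, s \in `[u, v] & path_depth a b w s <= 0].

Lemma measurable_exits_within a b (u v : R) : 0 <= u -> u < v ->
  measurable (exits_within a b u v : set (path_space I)).
Proof.
move=> u0 uv.
pose near_exit n (q : rat) : set (path_space I) :=
  if ratr q \in `[u, v] then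
    position_in (time_of (ratr q)) [set y | depth a b y < n.+1%:R^-1] else set0.
rewrite [X in measurable X](_ : _ = position_in (time_of v) setT `&`
    \bigcap_n \bigcup_q near_exit n q); last first.
  apply/seteqP; split=> [w [wv ex]|w [[yv wv _] ex]].
    split; first by case wvE: (coord w _) wv => [y|//] _; exists y.
    move=> n _; have [q quv] := (exit_within_ratP _ _ _ _ _ u0 uv wv).1 ex n.
    have : coord w (time_of (ratr q)) <> None.
      apply: coord_alive_le wv.
      by move: quv; rewrite in_itv/= => /andP[uq qv]; rewrite !time_ofE//; lra.
    rewrite /path_depth; case wq: (coord w _) => [y|//] _ yn.
    by exists q => //; rewrite /near_exit quv; exists y.
  have {}wv : coord w (time_of v) <> None by rewrite wv.
  split=> //; apply/(exit_within_ratP _ _ _ _ _ u0 uv wv) => n.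
  have [q _] := ex n Logic.I; rewrite /near_exit; case: ifPn => // quv [y wq yn].
  by exists q => //; rewrite /path_depth wq.
apply: measurableI; first exact: measurable_position_in.
apply: bigcapT_measurable => n; apply: bigcupT_measurable_rat => q.
rewrite /near_exit; case: ifP => // _; apply: measurable_position_in.
rewrite -preimage_itvNyo -[X in measurable X]setTI.
exact: measurable_depth.
Qed.

Lemma exit_time_ge0 a b w : (0 <= exit_time a b w)%E.
Proof. by apply: le_ereal_inf_tmp => _ [t _ <-]; rewrite lee_fin. Qed.

(** An exit at time s < t is captured by rationals u < s < v < t with v so close
    to s that the path is still alive at v, because the lifetime is open to the
    right. *)
Lemma exit_time_lt a b (t : \bar R) :
  [set w : path I | (exit_time a b w < t)%E] =
  \bigcup_(p : rat * rat)
    if (0 < ratr p.1 :> R) && (ratr p.1 < ratr p.2 :> R) &&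
       ((ratr p.2)%:E < t)%E
    then exits_within a b (ratr p.1) (ratr p.2) else set0.
Proof.
apply/seteqP; split=> [w /= /ereal_inf_lt[_ [s [s0 [y ws yab]] <-] st]|w].
  have [d d0 wd] := coord_cont ws ltr01.
  have [u] := rat_in_itvoo s0; rewrite in_itv/= => /andP[u0 us].
  (* For t = +oo only the bound s + d on v remains. *)
  have [v] : exists v : rat,
      s%:num < ratr v < s%:num + d /\ ((ratr v)%:E < t)%E.
    move: t st => [t| |//] st.
      have [|v] := @rat_in_itvoo _ s%:num (Num.min (s%:num + d) t).
        by rewrite lt_min ltrDl d0 -lte_fin.
      rewrite in_itv/= lt_min => /and3P[sv vd vt]; exists v.
      by rewrite lte_fin sv vd.
    have [|v vs] := @rat_in_itvoo _ s%:num (s%:num + d); first by rewrite ltrDl.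
    by exists v; move: vs; rewrite in_itv/= => ->; rewrite ltry.
  move=> [/andP[sv vd] vt].
  exists (u, v) => //=; rewrite u0 (lt_trans us sv) vt /=; split.
    have [|z -> //] := wd (time_of (ratr v)).
    rewrite time_ofE ?ltr_norml; last lra.
    by apply/andP; split; lra.
  exists s%:num; first by rewrite in_itv/= !ltW.
  rewrite /path_depth (_ : time_of s%:num = s) ?ws ?leNgt ?depth_gt0//.
  by apply/val_inj; rewrite /= time_ofE.
case=> -[u v] _ /=; case: ifP => // /andP[/andP[u0 uv] vt] [wv [s]].
rewrite in_itv/= => /andP[us sv] sab.
have : coord w (time_of s) <> None.
  by apply: coord_alive_le wv; rewrite !time_ofE//; lra.
move: sab; rewrite /path_depth; case ws: (coord w _) => [y|//] yab _.
apply: le_lt_trans vt; apply: (@le_trans _ _ s%:E); last by rewrite lee_fin.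
apply: ereal_inf_lbound; exists (time_of s); last by rewrite time_ofE//; lra.
split; first by rewrite /= normr_gt0 gt_eqF//; lra.
by exists y => //; rewrite -depth_gt0 -leNgt.
Qed.

Lemma measurable_exit_time a b :
  measurable_fun [set: path_space I] (exit_time a b : path_space I -> \bar R).
Proof.
apply: (measurability (@ErealGenInftyO.G R)) => //.
  exact: ErealGenInftyO.measurableE.
move=> _ [_ [t ->] <-]; rewrite setTI.
have -> : (exit_time a b : path_space I -> \bar R) @^-1` `]-oo, t%:E[%classic =
    [set w | (exit_time a b w < t%:E)%E].
  by apply/seteqP; split=> w /=; rewrite in_itv.
rewrite exit_time_lt; apply: countable_bigcupT_measurable => // -[u v] /=.
case: ifP => // /andP[/andP[u0 uv] _]; exact: measurable_exits_within (ltW u0) uv.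
Qed.

(** * Survival before the exit time *)

Lemma killed_positionE a b (t : {nonneg R}) (A : set R) :
  [set w : path I | exists2 y, killed (exit_time a b) t w = Some y & A y] =
  [set w | (t%:num%:E < exit_time a b w)%E] `&` position_in t A.
Proof.
rewrite /killed; apply/seteqP; split=> w /=.
  by case: ifPn => tT [y wt Ay] //; split => //; exists y.
by move=> [-> [y wt Ay]]; exists y.
Qed.

(** A finite exit time is witnessed by an actual position at some time s; that
    time is at least the exit time, hence after t, so the path cannot have died
    by time t. *)
Lemma alive_inside_before_exit a b w (t : {nonneg R}) : 0 < t%:num ->
  (t%:num%:E < exit_time a b w)%E -> (exit_time a b w < +oo)%E ->
  position_in t `]a, b[ w.
Proof.
move=> t0 tT /ereal_inf_lt[_ [s [s0 [y ws yab]] <-] _].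
have : coord w t <> None.
  apply: (@coord_alive_le w t s); last by rewrite ws.
  rewrite -lee_fin; apply/ltW/(lt_le_trans tT).
  by apply: ereal_inf_lbound; exists s => //; split => //; exists y.
case wt: (coord w t) => [z|//] _; exists z => //=.
apply/negPn/negP => zab; move: tT; apply/negP; rewrite -leNgt.
by apply: ereal_inf_lbound; exists t => //; split => //; exists z.
Qed.

End ExitTime.

Local Open Scope ereal_scope.

(** * Expectation as an integral of survival probabilities *)

Lemma probability_eq_mod_null d (T : measurableType d) (R : realType)
    (P : probability T R) (F A B : set T) :
  measurable F -> measurable A -> measurable B -> P F = 1 ->
  A `&` F = B `&` F -> P A = P B.
Proof.
move=> mF mA mB PF AB.
have PI C : measurable C -> P (C `&` F) = P C.
  move=> mC; have mCF : measurable (C `&` F) by exact: measurableI.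
  have mCF' : measurable (C `&` ~` F) by exact/measurableI/measurableC.
  rewrite -[in RHS](setIT C) -(setUv F) setIUr measureU//; last first.
    by rewrite setIACA setICr setI0.
  suff : P (C `&` ~` F) <= 0 by rewrite measure_le0 => /eqP ->; rewrite adde0.
  have <- : P (~` F) = 0 by rewrite probability_setC// PF subee.
  by apply: le_measure; rewrite ?inE//; exact: measurableC.
by rewrite -(PI A)// AB PI.
Qed.

(** The tail formula for real random variables, applied to [fine \o X].  Since
    [fine] sends oo to 0, the survival events of X and of [fine \o X] differ on
    the null event X = oo, hence the passage through [probability_eq_mod_null]. *)
Lemma ge0_integral_survival d (T : measurableType d) (R : realType)
    (P : probability T R) (X : T -> \bar R) :
  measurable_fun setT X -> (forall w, 0 <= X w) -> P [set w | X w < +oo] = 1 ->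
  \int[P]_w X w =
  \int[lebesgue_measure]_(t in `]0%R, +oo[) P [set w | t%:E < X w].
Proof.
move=> mX X0 PX.
have mXoo : measurable [set w | X w < +oo].
  by rewrite -[X in measurable X]setTI; exact: emeasurable_fun_infty_o.
have PXoo : P (~` [set w | X w < +oo]) = 0.
  by rewrite probability_setC// PX subee.
have mfX : measurable_fun setT (fine \o X) by exact: measurableT_comp.
pose Y : {RV P >-> R} := HB.pack (fine \o X) (
  isMeasurableFun.Build _ _ _ _ _ mfX).
transitivity ('E_P[Y]).
  rewrite unlock; apply: ge0_ae_eq_integral => //.
  - exact/measurable_EFinP.
  - by move=> w _; rewrite /= lee_fin fine_ge0.
  exists (~` [set w | X w < +oo]); split.
  - exact: measurableC.
  - exact: PXoo.
  - by move=> w /= + Xw; apply => _; rewrite fineK// ge0_fin_numE.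
rewrite ge0_expectation_ccdf; last by move=> w; rewrite /= fine_ge0.
rewrite -integral_itv_obnd_cbnd; last first.
  by apply: measurable_funTS; exact: ccdf_measurable.
apply: eq_integral => t; rewrite inE/= in_itv/= andbT => t0.
apply: (@probability_eq_mod_null _ _ _ _ [set w | X w < +oo]) => //.
- rewrite -[X in measurable X]setTI; exact: measurable_funP.
- by rewrite -[X in measurable X]setTI; exact: emeasurable_fun_o_infty.
apply/seteqP; split=> w /= [+ Xw]; rewrite in_itv/= andbT => tX; split=> //.
  by rewrite -(@fineK _ (X w)) ?lte_fin// ge0_fin_numE.
by rewrite -lte_fin fineK// ge0_fin_numE.
Qed.

Theorem proposition2p1 (R : realType) (I : set R)
    (P : R -> probability (path_space I) R) (m : {measure set R -> \bar R})
    (a b x : R) (qhat : R -> R -> R -> R)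
    (HX : regular_diffusion P) (Hm : speed_measure P m)
    (Ha : I a) (Hb : I b) (Hab : (a < b)%R) (Hx : `]a, b[%classic x)
    (Hqhat : transition_density `]a, b[ (killed (exit_time a b)) P m qhat)
    (HT : P x [set w | exit_time a b w < +oo] = 1) :
  \int[P x]_w exit_time a b w =
  \int[lebesgue_measure]_(t in `]0%R, +oo[)
    \int[m]_(z in `]a, b[) (qhat t x z)%:E.
Proof.
have mT := @measurable_exit_time R I a b.
rewrite ge0_integral_survival//; last by move=> w; exact: exit_time_ge0.
apply: eq_integral => t; rewrite inE/= in_itv/= andbT => t0.
have tE : (NngNum (ltW t0))%:num = t by [].
rewrite -[t in qhat t]tE -(density_law Hqhat)//= killed_positionE tE.
have mlt : measurable ([set w | t%:E < exit_time a b w] : set (path_space I)).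
  by rewrite -[X in measurable X]setTI; exact: emeasurable_fun_o_infty.
apply: (@probability_eq_mod_null _ (path_space I) _ (P x)
  [set w | exit_time a b w < +oo]) => //.
- by rewrite -[X in measurable X]setTI; exact: emeasurable_fun_infty_o.
- apply: measurableI => //; apply: measurable_position_in.
  exact: measurable_itv.
apply/seteqP; split=> w /= [].
  by move=> tT Too; split => //; split => //;
    exact: (@alive_inside_before_exit _ _ a b w (NngNum (ltW t0))).
by move=> [tT _] Too.
Qed.
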